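(* Let $X$ be a strongly positive definite metric space and $\alpha\in\mathbb{R}$. Then the function $$f:2^X\to\mathbb{R},\qquad f(Y)=\begin{cases}-|Y|^{-1} & \text{if } Y\neq\emptyset\\ \alpha & \text{if } Y=\emptyset\end{cases}$$ is increasing if $\alpha<-1$ and strictly submodular if $\alpha<-\tfrac32$. In particular, for any finite metric space $X'$ there is $T>0$ such that for all $t>T$ and all $\alpha<-\tfrac32$, the function $f$ defined in the same way on the subspaces of $tX'$ is strictly submodular.
   Context: Metric spaces $(X,d)$ are finite and nonempty; $tX=(X,t\cdot d)$; subsets carry the restricted metric. The similarity matrix $Z\in\mathbb{R}^{X\times X}$ has entries $z_{ij}=e^{-d(i,j)}$; $X$ is positive definite if $Z$ is. Then the weighting is $\mathbf{w}=Z^{-1}\mathbf{1}$ and the magnitude is $|X|=\mathbf{1}^T\mathbf{w}$ ($\mathbf{1}$ the all-ones vector); nonempty subspaces of positive definite spaces are positive definite. $K=\tfrac12\big(I-\tfrac{\mathbf{1}\mathbf{1}^T}{n}\big)Z\big(I-\tfrac{\mathbf{1}\mathbf{1}^T}{n}\big)$ with $n=\#X$, and $K^\dagger$ is its Moore--Penrose pseudoinverse. $X$ is strongly positive definite if it is positive definite, $-(K^\dagger)_{ij}>0$ for all distinct $i,j\in X$, and $\mathbf{w}>0$ entrywise. A function $f:2^X\to\mathbb{R}$ is strictly submodular if $f(Y)-f(Y\setminus\{y\})<f(Y\setminus\{x\})-f(Y\setminus\{x,y\})$ for all $Y\subseteq X$ and distinct $x,y\in Y$. It is increasing if $f(A)<f(B)$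 whenever $A\subsetneq B\subseteq X$. *)

(* Defs.v *)
From HB Require Import structures.
From mathcomp Require Import all_boot all_order all_algebra.
From mathcomp Require Import all_classical all_reals all_analysis.

Set Implicit Arguments.
Unset Strict Implicit.
Unset Printing Implicit Defensive.

Import Order.TTheory GRing.Theory Num.Theory.
Local Open Scope ring_scope.

Section LinearAlgebra.
Variable R : realType.

Definition posdefmx n (M : 'M[R]_n) : Prop :=
  M^T = M /\ forall v : 'cV[R]_n, v != 0 -> 0 < (v^T *m M *m v) 0 0.

(* The four Penrose equations over the reals. MathComp's [pinvmx A] is only
   some generalized inverse of A, not the Moore--Penrose one. *)
Definition is_MPinverse m n (A : 'M[R]_(m, n)) (B : 'M[R]_(n, m)) : Prop :=
  [/\ A *m B *m A = A, B *m A *m B = B,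
      (A *m B)^T = A *m B & (B *m A)^T = B *m A].

(* [MPinverse_spec] and [MPinverse_unique] show that this selects the only
   candidate, so the default value 0 plays no role. *)
Definition MPinverse m n (A : 'M[R]_(m, n)) : 'M[R]_(n, m) :=
  xget 0 [set B | is_MPinverse A B]%classic.

Lemma MPinverse_unique m n (A : 'M[R]_(m, n)) (B C : 'M[R]_(n, m)) :
  is_MPinverse A B -> is_MPinverse A C -> B = C.
Proof.
move=> [ABA BAB ABT BAT] [ACA CAC ACT CAT].
have AB_AC : A *m B = A *m C.
  by rewrite -ABT -[in LHS]ACA -mulmxA trmx_mul ABT ACT mulmxA ABA.
have BA_CA : B *m A = C *m A.
  by rewrite -BAT -[in LHS]ACA -mulmxA mulmxA trmx_mul BAT CAT -mulmxA
             (mulmxA A) ABA.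
by rewrite -BAB BA_CA -mulmxA AB_AC mulmxA CAC.
Qed.

Lemma mulmx_trmx_eq0 n (v : 'rV[R]_n) : v *m v^T = 0 -> v = 0.
Proof.
move=> /(congr1 (fun M : 'M[R]_1 => M 0 0)); rewrite !mxE => /eqP.
rewrite psumr_eq0; last by move=> i _; rewrite mxE -expr2 sqr_ge0.
move=> /allP v0; apply/rowP => i; rewrite mxE; apply/eqP.
by have := v0 i (mem_index_enum i); rewrite mxE -expr2 sqrf_eq0.
Qed.

Lemma gram_unitmx m n (B : 'M[R]_(m, n)) : row_free B -> B *m B^T \in unitmx.
Proof.
move=> fB; rewrite -row_free_unit; apply/inj_row_free => v vBB0.
apply: (row_free_inj fB); rewrite mul0mx; apply: mulmx_trmx_eq0.
by rewrite trmx_mul mulmxA -(mulmxA v) vBB0 mul0mx.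
Qed.

Lemma full_rank_MPinverse m n r (C : 'M[R]_(m, r)) (D : 'M[R]_(r, n)) :
  row_full C -> row_free D -> exists B, is_MPinverse (C *m D) B.
Proof.
move=> fC fD.
have uD : D *m D^T \in unitmx by exact: gram_unitmx.
have uC : C^T *m C \in unitmx.
  have := @gram_unitmx _ _ C^T; rewrite trmxK; apply.
  by rewrite /row_free mxrank_tr; exact: fC.
pose G := invmx (D *m D^T); pose H := invmx (C^T *m C).
have GT : G^T = G by rewrite trmx_inv trmx_mul trmxK.
have HT : H^T = H by rewrite trmx_inv trmx_mul trmxK.
pose B := D^T *m G *m (H *m C^T).
have DG : D *m D^T *m G = 1%:M by exact: mulmxV.
have HC : H *m (C^T *m C) = 1%:M by exact: mulVmx.
have AB : C *m D *m B = C *m H *m C^T.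
  have -> : C *m D *m B = C *m (D *m D^T *m G) *m (H *m C^T).
    by rewrite /B !mulmxA.
  by rewrite DG mulmx1 mulmxA.
have BA : B *m (C *m D) = D^T *m G *m D.
  have -> : B *m (C *m D) = D^T *m G *m (H *m (C^T *m C)) *m D.
    by rewrite /B !mulmxA.
  by rewrite HC mulmx1.
exists B; split.
- have -> : C *m D *m B *m (C *m D) = C *m (H *m (C^T *m C)) *m D.
    by rewrite AB !mulmxA.
  by rewrite HC mulmx1.
- have -> : B *m (C *m D) *m B = D^T *m G *m (D *m D^T *m G) *m (H *m C^T).
    by rewrite BA /B !mulmxA.
  by rewrite DG mulmx1.
- by rewrite AB !trmx_mul trmxK HT mulmxA.
- by rewrite BA !trmx_mul trmxK GT mulmxA.
Qed.

Lemma MPinverse_spec m n (A : 'M[R]_(m, n)) : is_MPinverse A (MPinverse A).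
Proof.
rewrite /MPinverse; case: xgetP => // noB; exfalso.
have [B] := full_rank_MPinverse (col_base_full A) (row_base_free A).
by rewrite mulmx_base => /noB.
Qed.

End LinearAlgebra.

Section Magnitude.
Variable R : realType.

(* A finite metric space is a finType with a distance function satisfying
   [is_metric], which includes nonemptiness. The distance is kept separate from
   the carrier because the same carrier is rescaled. *)
Definition is_metric (X : finType) (d : X -> X -> R) : Prop :=
  [/\ (0 < #|X|)%N,
      forall x y, 0 <= d x y,
      forall x y, d x y = 0 <-> x = y,
      forall x y, d x y = d y x &
      forall x y z, d x z <= d x y + d y z].

Definition scaled (X : finType) (t : R) (d : X -> X -> R) : X -> X -> R :=
  fun x y => t * d x y.

Definition restricted (X : finType) (d : X -> X -> R) (Y : {set X}) :
    {x | x \in Y} -> {x | x \in Y} -> R :=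
  fun u v => d (val u) (val v).

(* Matrices indexed by a finite type X are indexed by 'I_#|X| through the
   bijection [enum_val]. *)
Definition simmx (X : finType) (d : X -> X -> R) : 'M[R]_#|X| :=
  \matrix_(i, j) expR (- d (enum_val i) (enum_val j)).

Definition positive_definite (X : finType) (d : X -> X -> R) : Prop :=
  posdefmx (simmx d).

(* Only meaningful when [simmx d] is invertible, as it is when it is positive
   definite; the same applies to [magnitude]. *)
Definition weighting (X : finType) (d : X -> X -> R) : 'cV[R]_#|X| :=
  invmx (simmx d) *m const_mx 1.

Definition magnitude (X : finType) (d : X -> X -> R) : R :=
  ((const_mx 1 : 'cV[R]_#|X|)^T *m weighting d) 0 0.

Definition centermx n : 'M[R]_n :=
  1%:M - n%:R^-1 *: ((const_mx 1 : 'cV[R]_n) *m (const_mx 1 : 'cV[R]_n)^T).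

Definition Kmx (X : finType) (d : X -> X -> R) : 'M[R]_#|X| :=
  2^-1 *: (centermx #|X| *m simmx d *m centermx #|X|).

Definition strongly_positive_definite (X : finType) (d : X -> X -> R) : Prop :=
  [/\ positive_definite d,
      forall i j : 'I_#|X|, i != j -> 0 < - MPinverse (Kmx d) i j &
      forall i : 'I_#|X|, 0 < weighting d i 0].

Definition neg_inv_magnitude (X : finType) (d : X -> X -> R) (alpha : R)
    (Y : {set X}) : R :=
  if Y == finset.set0 then alpha else - (magnitude (@restricted X d Y))^-1.

End Magnitude.

Section SetFunctions.
Variables (R : realType) (X : finType).
Local Open Scope set_scope.

Definition strictly_submodular (f : {set X} -> R) : Prop :=
  forall (Y : {set X}) (x y : X), x \in Y -> y \in Y -> x != y ->
    (f Y - f (Y :\ y) < f (Y :\ x) - f (Y :\: [set x; y]))%R.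

Definition set_increasing (f : {set X} -> R) : Prop :=
  forall A B : {set X}, A \proper B -> (f A < f B)%R.

End SetFunctions.

(* Main.v *)
Require Import Defs.
From mathcomp Require Import all_boot all_order all_algebra.
From mathcomp Require Import all_classical all_reals all_analysis.
From mathcomp Require Import ring lra.

(** Border the similarity matrix Z_Y of a nonempty subspace Y by a row and a
    column of ones. Up to the value f(Y) = -1/|Y|, the whole problem is about
    the inverse of this bordered matrix:
<<
      [ 0   1^T ]^-1      [ f(Y)  p^T ]
      [ 1   Z_Y ]      =  [  p     M  ]
>>
    Here p is the weighting w divided by |Y|, and M = Z_Y^-1 - w w^T / |Y| is
    half of the Moore-Penrose inverse of K ([MPinverse_Kmx]). So X is strongly
    positive definite exactly when, besides Z being positive definite, p > 0
    and M has negative off-diagonal entries; as the columns of M sum to 0, its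
    diagonal is then positive as soon as there are two points.

    Deleting a point x from Y deletes a row and a column of the bordered matrix,
    which takes a Schur complement in the inverse ([bordered_inverseD1]):
<<
      f' = f - p_x^2 / M_xx,            p'_y = p_y - M_yx p_x / M_xx,
      M'_yz = M_yz - M_yx M_xz / M_xx.
>>
    The sign conditions pass to Y \ x, so they hold for every nonempty subspace.
    The first formula says that f(Y) - f(Y \ x) = p_x^2 / M_xx > 0, hence f is
    increasing. Moreover p'_y > p_y and 0 < M'_yy <= M_yy, hence
<<
      f(Y) - f(Y \ y) = p_y^2 / M_yy < p'_y^2 / M'_yy
                      = f(Y \ x) - f(Y \ {x, y}),
>>
    which is strict submodularity when Y has a third point. Only the steps that
    reach the empty set involve alpha: a point has f = -1, and two points at
    distance d have f = -(1 + e^-d) / 2 < -1/2.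

    For the last claim, the similarity matrix of tX' tends to the identity as t
    grows, and the identity satisfies all the strict inequalities of strong
    positive definiteness with room to spare
    ([strongly_positive_definite_of_separated]). *)

Set Implicit Arguments.
Unset Strict Implicit.
Unset Printing Implicit Defensive.

Import Order.TTheory GRing.Theory Num.Theory.
Local Open Scope set_scope.
Local Open Scope ring_scope.

(** * Inverses of bordered matrices and deletion of a point *)

(** The blocks f, p, M of the inverse of z bordered by ones, over the points of
    Y, with the sign conditions that deletion of a point preserves. The blocks
    are functions on all of X, whose values outside Y are free apart from the
    symmetry of M, so that passing to a subset needs no reindexing. *)
Record bordered_inverse (R : realType) (X : finType) (z : X -> X -> R)
    (Y : {set X}) (f : R) (p : X -> R) (M : X -> X -> R) : Prop := {
  bi_sum_p : \sum_(i in Y) p i = 1;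
  bi_zp : forall i, i \in Y -> \sum_(j in Y) z i j * p j = - f;
  bi_sum_M : forall j, j \in Y -> \sum_(i in Y) M i j = 0;
  bi_zM : forall i j, i \in Y -> j \in Y ->
    \sum_(k in Y) z i k * M k j = (i == j)%:R - p j;
  bi_sym : forall i j, M i j = M j i;
  bi_p_gt0 : forall i, i \in Y -> 0 < p i;
  bi_M_lt0 : forall i j, i \in Y -> j \in Y -> i != j -> M i j < 0;
  bi_f_lt0 : f < 0 }.

(** Column x of M sums to 0 and its off-diagonal entries are negative. *)
Lemma bi_diag_gt0 (R : realType) (X : finType) (z : X -> X -> R) Y f p M x y :
  bordered_inverse z Y f p M -> x \in Y -> y \in Y -> x != y -> 0 < M x x.
Proof.
move=> B xY yY xy; have := bi_sum_M B xY.
rewrite (big_setD1 x) //= (big_setD1 y) /=; last by rewrite !inE eq_sym xy.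
have Myx : M y x < 0 by apply: (bi_M_lt0 B); rewrite // eq_sym.
have : \sum_(i in Y :\ x :\ y) M i x <= 0.
  by apply: sumr_le0 => i /setD1P[_ /setD1P[ix iY]]; apply/ltW/(bi_M_lt0 B).
lra.
Qed.

(** Strict growth of p under deletion, which makes submodularity strict. *)
Lemma schur_p_gt (R : realType) (X : finType) (z : X -> X -> R) Y f p M x y :
  bordered_inverse z Y f p M -> x \in Y -> y \in Y -> x != y ->
  p y < p y - M y x / M x x * p x.
Proof.
move=> B xY yY xy; have Mxx := bi_diag_gt0 B xY yY xy.
have Myx : M y x < 0 by apply: (bi_M_lt0 B); rewrite // eq_sym.
by rewrite ltrDl oppr_gt0 pmulr_llt0 ?(bi_p_gt0 B) // pmulr_llt0 ?invr_gt0.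
Qed.

(** Schur complement. The new p and M, extended by the same formulas to x
    itself, vanish there, so sums over Y and over Y minus x agree. *)
Lemma bordered_inverseD1 (R : realType) (X : finType) (z : X -> X -> R)
    Y f p M x y :
  bordered_inverse z Y f p M -> x \in Y -> y \in Y -> x != y ->
  bordered_inverse z (Y :\ x) (f - p x ^+ 2 / M x x)
    (fun i => p i - M i x / M x x * p x)
    (fun i j => M i j - M i x / M x x * M x j).
Proof.
move=> B xY yY xy; have Mxx := bi_diag_gt0 B xY yY xy.
have Mxx0 : M x x != 0 by rewrite gt_eqF.
have sumD1 (F : X -> R) : F x = 0 -> \sum_(i in Y :\ x) F i = \sum_(i in Y) F i.
  by move=> Fx; rewrite [RHS](big_setD1 x) //= Fx add0r.
have elim_sum (a b : X -> R) (c : R) :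
    \sum_(i in Y) a i * (b i - M i x / M x x * c) =
    \sum_(i in Y) a i * b i - (\sum_(i in Y) a i * M i x) / M x x * c.
  rewrite !mulr_suml -sumrB; apply: eq_bigr => i _; ring.
have elim_sum1 (b : X -> R) (c : R) :
    \sum_(i in Y) (b i - M i x / M x x * c) =
    \sum_(i in Y) b i - (\sum_(i in Y) M i x) / M x x * c.
  by rewrite !mulr_suml -sumrB.
split.
- rewrite sumD1 ?divff ?mul1r ?subrr // elim_sum1 (bi_sum_M B) //.
  by rewrite !mul0r subr0 (bi_sum_p B).
- move=> i /setD1P[ix iY].
  rewrite sumD1; last by rewrite divff // mul1r subrr mulr0.
  by rewrite elim_sum (bi_zp B) // (bi_zM B) // (negPf ix) /=; field.
- move=> j /setD1P[jx jY]; rewrite sumD1 ?divff ?mul1r ?subrr //.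
  by rewrite elim_sum1 !(bi_sum_M B) // !mul0r subr0.
- move=> i j /setD1P[ix iY] /setD1P[jx jY].
  rewrite sumD1; last by rewrite divff // mul1r subrr mulr0.
  by rewrite elim_sum !(bi_zM B) // (negPf ix) (bi_sym B x j) /=; field.
- by move=> i j; rewrite (bi_sym B i j) (bi_sym B i x) (bi_sym B x j); ring.
- move=> i /setD1P[ix iY]; have xi : x != i by rewrite eq_sym.
  apply: lt_trans (schur_p_gt B xY iY xi).
  exact: (bi_p_gt0 B).
- move=> i j /setD1P[ix iY] /setD1P[jx jY] ij.
  have Mij := bi_M_lt0 B iY jY ij.
  apply: le_lt_trans Mij; rewrite gerDl oppr_le0 mulr_le0 //.
    by rewrite pmulr_lle0 ?invr_gt0 //; apply/ltW/(bi_M_lt0 B).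
  by apply/ltW/(bi_M_lt0 B); rewrite // eq_sym.
- apply: le_lt_trans (bi_f_lt0 B).
  by rewrite gerDl oppr_le0 divr_ge0 ?sqr_ge0 // ltW.
Qed.

(** * Magnitudes of subspaces *)

(** Pointwise form of the definition, free of the enumeration of the carrier. *)
Lemma magnitude_of_inverse (R : realType) (T : finType) (d : T -> T -> R)
    (G : T -> T -> R) :
  (forall x u, \sum_y expR (- d x y) * G y u = (x == u)%:R) ->
  magnitude d = \sum_u \sum_x G x u.
Proof.
move=> zG.
pose N : 'M[R]_#|T| := \matrix_(i, j) G (enum_val i) (enum_val j).
have ZN : simmx d *m N = 1%:M.
  apply/matrixP => i j; rewrite !mxE -(inj_eq enum_val_inj) -zG.
  rewrite [RHS](big_enum_val (A := T)) /=.
  by apply: eq_bigr => k _; rewrite !mxE.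
have [uZ _] := mulmx1_unit ZN.
have -> : magnitude d = \sum_j \sum_i N i j.
  rewrite /magnitude /weighting -(mulmx1 (invmx _)) -ZN mulKmx //.
  rewrite mulmxA !mxE; apply: eq_bigr => j _; rewrite !mxE mulr1.
  by apply: eq_bigr => i _; rewrite !mxE mul1r.
rewrite [RHS](big_enum_val (A := T)) /=; apply: eq_bigr => j _.
by rewrite [RHS](big_enum_val (A := T)) /=; apply: eq_bigr => i _; rewrite !mxE.
Qed.

(** The bordered system gives Z_Y^-1 = M - p p^T / f. Its entries sum to -1/f,
    as M sums to 0 and p sums to 1. *)
Lemma neg_inv_magnitudeE (R : realType) (X : finType) (d : X -> X -> R) alpha
    (Y : {set X}) f p M :
  bordered_inverse (fun x y => expR (- d x y)) Y f p M -> Y != finset.set0 ->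
  neg_inv_magnitude d alpha Y = f.
Proof.
move=> B /negPf Y0; rewrite /neg_inv_magnitude Y0.
have f0 : f != 0 by rewrite lt_eqF // (bi_f_lt0 B).
pose G x y := M x y - p x * p y / f.
have sumE (F : X -> R) : \sum_(x : {x | x \in Y}) F (val x) = \sum_(x in Y) F x.
  by rewrite [RHS]big_sub.
rewrite (@magnitude_of_inverse R _ (@restricted R X d Y)
  (fun x y => G (val x) (val y))).
- rewrite (sumE (fun u => \sum_(x : {x | x \in Y}) G (val x) u)).
  have -> : \sum_(u in Y) \sum_(x : {x | x \in Y}) G (val x) u =
            \sum_(u in Y) (- p u / f).
    apply: eq_bigr => u uY; rewrite (sumE (G^~ u)) sumrB (bi_sum_M B) //.
    by rewrite -!mulr_suml (bi_sum_p B) mul1r sub0r mulNr.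
  by rewrite -mulr_suml sumrN (bi_sum_p B); field.
- move=> x u; rewrite (sumE (fun y => expR (- d (val x) y) * G y (val u))).
  rewrite -val_eqE; have [xY uY] := (valP x, valP u).
  have -> : \sum_(y in Y) expR (- d (val x) y) * G y (val u) =
      \sum_(y in Y) expR (- d (val x) y) * M y (val u) -
      (\sum_(y in Y) expR (- d (val x) y) * p y) * (p (val u) / f).
    by rewrite mulr_suml -sumrB; apply: eq_bigr => y _; rewrite /G; ring.
  by rewrite (bi_zM B) // (bi_zp B) //; field.
Qed.

Lemma bordered_inverse_sub (R : realType) (X : finType) (z : X -> X -> R) :
  (exists f p M, bordered_inverse z [set: X] f p M) ->
  forall Y : {set X}, Y != finset.set0 ->
    exists f p M, bordered_inverse z Y f p M.
Proof.
move=> BT Y; have [n] := ubnP #|~: Y|; elim: n Y => // n IH Y.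
have [-> // | YT] := eqVneq Y [set: X].
have [x] : exists x, x \in ~: Y.
  by apply/set0Pn; rewrite -finset.setCT (inj_eq (@finset.setC_inj X)).
rewrite inE => xY cardY Y0.
have [||f [p [M B]]] := IH (x |: Y).
- have -> : ~: (x |: Y) = ~: Y :\ x by apply/setP => y; rewrite !inE negb_or.
  by move: cardY; rewrite (cardsD1 x) inE xY.
- by apply/set0Pn; exists x; rewrite finset.setU11.
- have [y yY] := set0Pn _ Y0.
  have xy : x != y by apply: contraNneq xY => ->.
  rewrite -(finset.setU1K xY); exists (f - p x ^+ 2 / M x x); do 2!eexists.
  by apply: (bordered_inverseD1 B (y := y)) => //; rewrite !inE ?eqxx ?yY ?orbT.
Qed.

Lemma bi_set1 (R : realType) (X : finType) (z : X -> X -> R) x f p M :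
  bordered_inverse z [set x] f p M -> f = - z x x.
Proof.
move=> B; have := bi_sum_p B; rewrite big_set1 => px.
have := bi_zp B (set11 x); rewrite big_set1 px mulr1 => ->.
by rewrite opprK.
Qed.

(** By symmetry the two equations Z p = - f 1 add up to
    (z x x + z x y) (p x + p y) = - 2 f. *)
Lemma bi_set2 (R : realType) (X : finType) (z : X -> X -> R) x y f p M :
  (forall u v, z u v = z v u) -> z x x = z y y -> x != y ->
  bordered_inverse z [set x; y] f p M -> f = - ((z x x + z x y) / 2).
Proof.
move=> zC zxy xy B.
have sum2 (F : X -> R) : \sum_(i in [set x; y]) F i = F x + F y.
  by rewrite big_setU1 ?inE // big_set1.
have := bi_sum_p B; rewrite sum2 => p1.
have := bi_zp B (set21 x y); have := bi_zp B (set22 x y).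
rewrite !sum2 (zC y x) -zxy => zy zx.
have : (z x x + z x y) * (p x + p y) = - f *+ 2.
  by rewrite mulr2n -{1}zx -zy; ring.
by rewrite p1 mulr1 => ->; field.
Qed.

(** * Monotonicity and submodularity *)

Lemma neg_inv_magnitude_increasing (R : realType) (X : finType)
    (d : X -> X -> R) (alpha : R) :
  (forall x, d x x = 0) ->
  (exists f p M,
    bordered_inverse (fun x y => expR (- d x y)) [set: X] f p M) ->
  alpha < -1 -> set_increasing (neg_inv_magnitude d alpha).
Proof.
move=> dxx BT alpha1.
have step (Y : {set X}) x : x \in Y ->
    neg_inv_magnitude d alpha (Y :\ x) < neg_inv_magnitude d alpha Y.
  move=> xY; have Y0 : Y != finset.set0 by apply/set0Pn; exists x.
  have [f [p [M B]]] := bordered_inverse_sub BT Y0.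
  rewrite (neg_inv_magnitudeE alpha B Y0).
  have [Yx0|Yx0] := eqVneq (Y :\ x) finset.set0.
    have Yx : Y = [set x] by rewrite -(finset.setD1K xY) Yx0 finset.setU0.
    rewrite Yx0 /neg_inv_magnitude eqxx; rewrite Yx in B.
    by rewrite (bi_set1 B) dxx oppr0 expR0.
  have [y /setD1P[yx yY]] := set0Pn _ Yx0.
  have xy : x != y by rewrite eq_sym.
  rewrite (neg_inv_magnitudeE alpha (bordered_inverseD1 B xY yY xy) Yx0).
  rewrite gtrDl oppr_lt0 divr_gt0 ?(bi_diag_gt0 B xY yY) //.
  by rewrite exprn_gt0 // (bi_p_gt0 B).
move=> A B; have [n] := ubnP #|B|; elim: n B => // n IH B cardB.
move=> /properP[AB [x xB xA]]; apply: le_lt_trans (step _ _ xB).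
have AB' : A \subset B :\ x by rewrite subsetD1 AB.
have [<- //|ABn] := eqVneq A (B :\ x).
apply/ltW/IH; last by rewrite finset.properEneq ABn.
by move: cardB; rewrite (cardsD1 x B) xB.
Qed.

Lemma neg_inv_magnitude_submodular (R : realType) (X : finType)
    (d : X -> X -> R) (alpha : R) :
  (forall x, d x x = 0) -> (forall x y, d x y = d y x) ->
  (exists f p M,
    bordered_inverse (fun x y => expR (- d x y)) [set: X] f p M) ->
  alpha < - (3 / 2) -> strictly_submodular (neg_inv_magnitude d alpha).
Proof.
move=> dxx dC BT alpha32 Y x y xY yY xy.
have Y0 : Y != finset.set0 by apply/set0Pn; exists x.
have yx : y != x by rewrite eq_sym.
have yYx : y \in Y :\ x by rewrite !inE yx.
have xYy : x \in Y :\ y by rewrite !inE xy.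
have Yx0 : Y :\ x != finset.set0 by apply/set0Pn; exists y.
have Yy0 : Y :\ y != finset.set0 by apply/set0Pn; exists x.
have [f [p [M B]]] := bordered_inverse_sub BT Y0.
have Bx := bordered_inverseD1 B xY yY xy.
have By := bordered_inverseD1 B yY xY yx.
have YxyE : Y :\: [set x; y] = Y :\ x :\ y.
  by rewrite finset.setDDl.
rewrite YxyE.
(* the case Y = {x, y}, where alpha enters *)
have [Yxy0|Yxy0] := eqVneq (Y :\ x :\ y) finset.set0.
  have YE : Y = [set x; y].
    by rewrite -(finset.setD1K xY) -(finset.setD1K yYx) Yxy0 finset.setU0.
  have [fx [px [Mx Bsx]]] := bordered_inverse_sub BT Yx0.
  have [fy [py [My Bsy]]] := bordered_inverse_sub BT Yy0.
  have -> : neg_inv_magnitude d alpha (Y :\ x :\ y) = alpha.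
    by rewrite /neg_inv_magnitude Yxy0 eqxx.
  rewrite (neg_inv_magnitudeE alpha B Y0) (neg_inv_magnitudeE alpha Bsx Yx0).
  rewrite (neg_inv_magnitudeE alpha Bsy Yy0).
  have Yx : Y :\ x = [set y] by rewrite YE setU1K // inE.
  have Yy : Y :\ y = [set x] by rewrite YE finset.setUC setU1K // inE.
  rewrite Yx in Bsx; rewrite Yy in Bsy; rewrite YE in B.
  have zC u v : expR (- d u v) = expR (- d v u) by rewrite dC.
  rewrite (bi_set1 Bsx) (bi_set1 Bsy) (bi_set2 zC _ xy B) !dxx //.
  have := expR_gt0 (- d x y); rewrite oppr0 expR0; lra.
have [u /setD1P[uy uYx]] := set0Pn _ Yxy0.
have Mxx := bi_diag_gt0 B xY yY xy.
have yu : y != u by rewrite eq_sym.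
have Nyy := bi_diag_gt0 Bx yYx uYx yu.
have Bxy := bordered_inverseD1 Bx yYx uYx yu.
rewrite (neg_inv_magnitudeE alpha B Y0) (neg_inv_magnitudeE alpha Bx Yx0).
rewrite (neg_inv_magnitudeE alpha By Yy0) (neg_inv_magnitudeE alpha Bxy Yxy0).
have py := schur_p_gt B xY yY xy.
have p0 := bi_p_gt0 B yY.
have subBB (a b : R) : a - (a - b) = b by ring.
rewrite !subBB.
(* deleting x first shrinks the denominator, strictly enlarges the numerator *)
apply: (@le_lt_trans _ _ (p y ^+ 2 / (M y y - M y x / M x x * M x y))).
  rewrite ler_pM2l ?exprn_gt0 // lef_pV2 ?posrE ?(bi_diag_gt0 B yY xY) //.
  rewrite gerDl oppr_le0 -(bi_sym B y x) mulrAC -expr2.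
  by rewrite divr_ge0 ?sqr_ge0 // ltW.
by rewrite ltr_pM2r ?invr_gt0 // ltrXn2r ?ltW // nnegrE ltW // (lt_trans p0).
Qed.

(** * The bordered inverse of a strongly positive definite space *)

Lemma magnitude_sum (R : realType) (X : finType) (d : X -> X -> R) :
  magnitude d = \sum_i weighting d i 0.
Proof.
by rewrite /magnitude mxE; apply: eq_bigr => i _; rewrite !mxE mul1r.
Qed.

(** The block M of the bordered inverse, for the whole space. *)
Definition bordered_block (R : realType) (X : finType) (d : X -> X -> R) :
    'M[R]_#|X| :=
  invmx (simmx d) - (magnitude d)^-1 *: (weighting d *m (weighting d)^T).

Lemma bordered_blockE (R : realType) (X : finType) (d : X -> X -> R) i j :
  bordered_block d i j =
    invmx (simmx d) i j - weighting d i 0 * weighting d j 0 / magnitude d.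
Proof. by rewrite !mxE big_ord1 !mxE [X in _ - X]mulrC. Qed.

Lemma const_mx_weighting (R : realType) (X : finType) (d : X -> X -> R) :
  (const_mx 1 : 'cV_#|X|)^T *m weighting d = (magnitude d)%:M.
Proof. by rewrite [LHS]mx11_scalar. Qed.

Lemma simmx_bordered_block (R : realType) (X : finType) (d : X -> X -> R) :
  simmx d \in unitmx ->
  simmx d *m bordered_block d =
    1%:M - (magnitude d)^-1 *: (const_mx 1 *m (weighting d)^T).
Proof.
move=> uZ; rewrite mulmxBr mulmxV // -scalemxAr mulmxA.
by rewrite [simmx d *m weighting d]mulKVmx.
Qed.

Lemma trmx_bordered_block (R : realType) (X : finType) (d : X -> X -> R) :
  (simmx d)^T = simmx d -> (bordered_block d)^T = bordered_block d.
Proof.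
by move=> ZT; rewrite linearB /= linearZ /= trmx_mul trmxK trmx_inv ZT.
Qed.

Lemma const_bordered_block (R : realType) (X : finType) (d : X -> X -> R) :
  (simmx d)^T = simmx d -> magnitude d != 0 ->
  (const_mx 1 : 'cV_#|X|)^T *m bordered_block d = 0.
Proof.
move=> ZT S0; rewrite mulmxBr -scalemxAr mulmxA const_mx_weighting.
rewrite mul_scalar_mx scalerA mulVf // scale1r /weighting trmx_mul trmx_inv ZT.
by rewrite subrr.
Qed.

(** With P the centering projection, P M = M P = M and Z M = 1 - 1 p^T give
    (P Z P) M = P Z M = P, and M (P Z P) = P by transposition. So M is the
    Moore-Penrose inverse of P Z P = 2 K, both products being the symmetric
    idempotent P. *)
Lemma MPinverse_Kmx (R : realType) (X : finType) (d : X -> X -> R) :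
  (0 < #|X|)%N -> simmx d \in unitmx -> (simmx d)^T = simmx d ->
  magnitude d != 0 -> MPinverse (Kmx d) = 2 *: bordered_block d.
Proof.
move=> X0 uZ ZT S0.
have n0 : #|X|%:R != 0 :> R by rewrite pnatr_eq0 -lt0n.
pose J : 'cV[R]_#|X| := const_mx 1; pose P : 'M[R]_#|X| := centermx R #|X|.
have JJ : J^T *m J = #|X|%:R%:M.
  rewrite [LHS]mx11_scalar mxE; congr (_%:M).
  under eq_bigr do rewrite !mxE mulr1.
  by rewrite sumr_const card_ord.
have PE : P = 1%:M - #|X|%:R^-1 *: (J *m J^T) by [].
have PT : P^T = P by rewrite PE linearB /= linearZ /= trmx_mul trmxK trmx1.
have PJ : P *m J = 0.
  rewrite PE mulmxBl mul1mx -scalemxAl -mulmxA JJ mul_mx_scalar scalerA.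
  by rewrite mulVf // scale1r subrr.
have PP : P *m P = P.
  by rewrite {2}PE mulmxBr mulmx1 -scalemxAr mulmxA PJ mul0mx scaler0 subr0.
have MT := trmx_bordered_block ZT.
have PM : P *m bordered_block d = bordered_block d.
  rewrite PE mulmxBl mul1mx -scalemxAl -mulmxA const_bordered_block //.
  by rewrite mulmx0 scaler0 subr0.
have MP : bordered_block d *m P = bordered_block d.
  by rewrite -{1}MT -PT -trmx_mul PM MT.
have PZM : P *m simmx d *m bordered_block d = P.
  rewrite -mulmxA simmx_bordered_block // mulmxBr mulmx1 -scalemxAr mulmxA PJ.
  by rewrite mul0mx scaler0 subr0.
have MZP : bordered_block d *m simmx d *m P = P.
  by have := congr1 trmx PZM; rewrite !trmx_mul MT ZT PT mulmxA.
have K2M : Kmx d *m (2 *: bordered_block d) = P.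
  rewrite /Kmx -/P -scalemxAl -scalemxAr scalerA mulVf ?pnatr_eq0 // scale1r.
  by rewrite -[LHS]mulmxA PM.
have M2K : (2 *: bordered_block d) *m Kmx d = P.
  rewrite /Kmx -/P -scalemxAl -scalemxAr scalerA divff ?pnatr_eq0 // scale1r.
  by rewrite !mulmxA MP.
apply: MPinverse_unique (MPinverse_spec _) _; split.
- by rewrite K2M /Kmx -/P -scalemxAr !mulmxA PP.
- by rewrite M2K -scalemxAr PM.
- by rewrite K2M PT.
- by rewrite M2K PT.
Qed.

Lemma posdef_unitmx (R : realType) n (M : 'M[R]_n) : posdefmx M -> M \in unitmx.
Proof.
move=> [MT Mpos]; rewrite -row_free_unit; apply/inj_row_free => v vM0.
apply/eqP/negPn/negP => v0.
have /Mpos : v^T != 0 by rewrite -trmx0 (inj_eq trmx_inj).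
by rewrite trmxK vM0 mul0mx mxE ltxx.
Qed.

Lemma bordered_inverse_setT (R : realType) (X : finType) (d : X -> X -> R) :
  is_metric d -> strongly_positive_definite d ->
  exists f p M, bordered_inverse (fun x y => expR (- d x y)) [set: X] f p M.
Proof.
move=> [X0 _ _ dC _] [Zpos offdiag wpos].
have ZT := Zpos.1; have uZ := posdef_unitmx Zpos.
have i0 : 'I_#|X| by exact: Ordinal X0.
have SE := magnitude_sum d.
have S0 : 0 < magnitude d.
  by rewrite SE (bigD1 i0) //= ltr_pwDl // sumr_ge0 // => i _; apply: ltW.
have Sn0 : magnitude d != 0 by rewrite gt_eqF.
rewrite (MPinverse_Kmx X0 uZ ZT Sn0) in offdiag.
have sumE (F : X -> R) : \sum_(x in [set: X]) F x =
      \sum_(i < #|X|) F (enum_val i).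
  rewrite [LHS](eq_bigl xpredT); last by move=> x; rewrite inE.
  by rewrite [LHS](big_enum_val (A := X)).
exists (- (magnitude d)^-1),
  (fun x => weighting d (enum_rank x) 0 / magnitude d),
  (fun x y => bordered_block d (enum_rank x) (enum_rank y)); split.
- rewrite sumE -mulr_suml; under eq_bigr do rewrite enum_valK.
  by rewrite -SE divff.
- move=> x _; rewrite sumE opprK -[RHS]mul1r.
  have : (simmx d *m weighting d) (enum_rank x) 0 = 1.
    by rewrite /weighting mulKVmx // mxE.
  rewrite mxE => <-; rewrite mulr_suml; apply: eq_bigr => i _.
  by rewrite enum_valK [simmx _ _ _]mxE enum_rankK mulrA.
- move=> y _; rewrite sumE; have := const_bordered_block ZT Sn0.
  move=> /matrixP/(_ 0 (enum_rank y)); rewrite [LHS]mxE [RHS]mxE => e.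
  rewrite -[RHS]e; apply: eq_bigr => i _.
  by rewrite enum_valK [_^T _ _]mxE [const_mx _ _ _]mxE mul1r.
- move=> x y _ _; rewrite sumE; have := simmx_bordered_block uZ.
  move=> /matrixP/(_ (enum_rank x) (enum_rank y)); rewrite [LHS]mxE => e.
  transitivity (\sum_j simmx d (enum_rank x) j *
      bordered_block d j (enum_rank y)).
    by apply: eq_bigr => i _; rewrite enum_valK [simmx _ _ _]mxE enum_rankK.
  rewrite e !mxE big_ord1 !mxE mul1r (inj_eq enum_rank_inj).
  by rewrite [X in _ - X]mulrC.
- by move=> x y; rewrite -{1}(trmx_bordered_block ZT) [LHS]mxE.
- by move=> x _; rewrite divr_gt0.
- move=> x y _ _ xy; have := offdiag (enum_rank x) (enum_rank y).
  by rewrite (inj_eq enum_rank_inj) => /(_ xy); rewrite !mxE; lra.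
- by rewrite oppr_lt0 invr_gt0.
Qed.

Lemma metric_diag (R : realType) (X : finType) (d : X -> X -> R) x :
  is_metric d -> d x x = 0.
Proof. by case=> _ _ d0 _ _; apply/d0. Qed.

(** * Large scale factors *)

(** Writing Z = I + E, the error term v^T E v is in absolute value at most eps
    times the square of the 1-norm of v, hence at most n eps |v|^2. *)
Lemma posdefmx_near_id (R : realType) n (Z : 'M[R]_n) (eps : R) :
  Z^T = Z -> (forall i j, `|Z i j - (i == j)%:R| <= eps) -> n%:R * eps < 1 ->
  posdefmx Z.
Proof.
move=> ZT Zdev neps; split=> // v v0; have Q0 : 0 < \sum_i v i 0 ^+ 2.
  have [i vi] : exists i, v i 0 != 0.
    apply/existsP; apply: contra_neqT v0 => /existsPn vi0.
    by apply/colP => i; rewrite mxE; apply/eqP/negPn/vi0.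
  rewrite (bigD1 i) //= ltr_pwDl ?exprn_even_gt0 //.
  by rewrite sumr_ge0 // => k _; rewrite sqr_ge0.
have -> : (v^T *m Z *m v) 0 0 = \sum_i \sum_j v i 0 * Z i j * v j 0.
  rewrite exchange_big mxE; apply: eq_bigr => j _ /=.
  by rewrite mxE mulr_suml; apply: eq_bigr => i _; rewrite mxE.
pose low i j := (if i == j then v i 0 ^+ 2 else 0) -
  eps / 2 * (v i 0 ^+ 2 + v j 0 ^+ 2).
apply: (@lt_le_trans _ _ (\sum_i \sum_j low i j)); last first.
  apply: ler_sum => i _; apply: ler_sum => j _.
  have -> : low i j = (i == j)%:R * v i 0 * v j 0 -
      eps / 2 * (v i 0 ^+ 2 + v j 0 ^+ 2).
    by rewrite /low; case: eqVneq => [->|_] /=; ring.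
  have := Zdev i j; rewrite ler_norml; set e := Z i j - _ => /andP[e1 e2].
  have -> : Z i j = e + (i == j)%:R by rewrite /e; ring.
  (* with a, b the two entries of v, the difference of the two sides is
     ((eps - e) (a - b)^2 + (eps + e) (a + b)^2) / 4 *)
  have e3 : 0 <= (eps - e) * (v i 0 - v j 0) ^+ 2.
    by rewrite mulr_ge0 ?sqr_ge0 // subr_ge0.
  have e4 : 0 <= (eps + e) * (v i 0 + v j 0) ^+ 2.
    by rewrite mulr_ge0 ?sqr_ge0 //; lra.
  by lra.
have -> : \sum_i \sum_j low i j = (1 - n%:R * eps) * \sum_i v i 0 ^+ 2.
  transitivity (\sum_i (v i 0 ^+ 2 -
      eps / 2 * (v i 0 ^+ 2 *+ n + \sum_j v j 0 ^+ 2))).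
    apply: eq_bigr => i _; rewrite sumrB -big_mkcond /= (big_pred1 i);
      last by move=> j; rewrite eq_sym.
    by rewrite -mulr_sumr big_split /= sumr_const card_ord.
  rewrite sumrB -mulr_sumr big_split /= sumrMnl sumr_const card_ord.
  by rewrite -[_ *+ n]mulr_natl; field.
by rewrite mulr_gt0 // subr_gt0.
Qed.

(** With Z = I + E and G the inverse, G = I - E G. Hence each entry of G differs
    from that of I by at most eps times the l^1 norm s of its column; summing
    over the column, s <= 1 + n eps s, so s <= 2. *)
Lemma invmx_near_id (R : realType) n (Z : 'M[R]_n) (eps : R) :
  Z \in unitmx -> (forall i j, `|Z i j - (i == j)%:R| <= eps) ->
  n%:R * eps <= 2^-1 ->
  forall i j, `|invmx Z i j - (i == j)%:R| <= 2 * eps.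
Proof.
move=> uZ Zdev neps; pose G := invmx Z; pose s j := \sum_k `|G k j|.
have Gdev i j : `|G i j - (i == j)%:R| <= eps * s j.
  have -> : G i j - (i == j)%:R = - \sum_k (Z i k - (i == k)%:R) * G k j.
    have : (Z *m G) i j = (i == j)%:R by rewrite mulmxV // mxE.
    rewrite mxE => <-; under [in RHS]eq_bigr do rewrite mulrBl.
    rewrite sumrB opprB; congr (_ - _).
    rewrite (bigD1 i) //= eqxx mul1r big1 ?addr0 // => k ki.
    by rewrite eq_sym (negPf ki) mul0r.
  rewrite normrN; apply: le_trans (ler_norm_sum _ _ _) _.
  rewrite mulr_sumr; apply: ler_sum => k _.
  by rewrite normrM ler_wpM2r.
have s_ge0 j : 0 <= s j by apply: sumr_ge0.
have s_le2 j : s j <= 2.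
  have s1 : s j <= 1 + n%:R * eps * s j.
    rewrite {1}/s; apply: (@le_trans _ _ (\sum_k ((k == j)%:R + eps * s j))).
      apply: ler_sum => k _; have := le_trans (lerB_dist _ _) (Gdev k j).
      by rewrite normr_nat lerBlDl.
    rewrite big_split /= sumr_const card_ord -[_ *+ n]mulr_natl mulrA lerD2r.
    by rewrite (bigD1 j) //= eqxx big1 ?addr0 // => k /negPf ->.
  by have := ler_wpM2r (s_ge0 j) neps; lra.
move=> i j; apply: le_trans (Gdev i j) _.
by rewrite mulrC ler_wpM2r // (le_trans _ (Zdev i j)).
Qed.

(** As the distances grow, Z tends to I, so w tends to 1, |X| to n, and half of
    the Moore-Penrose inverse of K to I - 1 1^T / n, whose off-diagonal entries
    are negative. The threshold 1/16 makes w stay within 1/8 of 1, and then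
    off the diagonal (Z^-1)_ij |X| <= 9/64 < 49/64 <= w_i w_j. *)
Lemma strongly_positive_definite_of_separated (R : realType) (X : finType)
    (d : X -> X -> R) :
  is_metric d ->
  (forall x y, x != y -> #|X|%:R * expR (- d x y) <= 16^-1) ->
  strongly_positive_definite d.
Proof.
move=> dm; have [X0 _ _ dC _] := dm; set n := #|X| => small.
have n_gt0 : 0 < n%:R :> R by rewrite ltr0n.
pose eps : R := (16 * n%:R)^-1.
have neps : n%:R * eps = 16^-1 by rewrite /eps; field; rewrite gt_eqF.
have eps_gt0 : 0 < eps by rewrite invr_gt0 mulr_gt0.
pose Z := simmx d.
have ZT : Z^T = Z by apply/matrixP => i j; rewrite !mxE dC.
have Zdev i j : `|Z i j - (i == j)%:R| <= eps.
  rewrite mxE; have [->|ij] := eqVneq i j.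
    by rewrite metric_diag // oppr0 expR0 subrr normr0 ltW.
  rewrite subr0 ger0_norm ?expR_ge0 // -(ler_pM2l n_gt0) neps small //.
  by rewrite (inj_eq enum_val_inj).
have Zpos : posdefmx Z by apply: posdefmx_near_id Zdev _; rewrite // neps; lra.
have uZ := posdef_unitmx Zpos.
have Gdev : forall i j, `|invmx Z i j - (i == j)%:R| <= 2 * eps.
  by apply: invmx_near_id uZ Zdev _; rewrite neps; lra.
have w_dev i : `|weighting d i 0 - 1| <= 8^-1.
  have -> : weighting d i 0 - 1 = \sum_j (invmx Z i j - (i == j)%:R).
    rewrite sumrB mxE; congr (_ - _).
      by apply: eq_bigr => j _; rewrite mxE mulr1.
    rewrite (bigD1 i) //= eqxx big1 ?addr0 // => k.
    by rewrite eq_sym => /negPf ->.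
  apply: le_trans (ler_norm_sum _ _ _) _.
  apply: (@le_trans _ _ (\sum_(j < n) 2 * eps)); first exact: ler_sum.
  by rewrite sumr_const card_ord -[_ *+ n]mulr_natl mulrCA neps; lra.
have w_bd i : 7 / 8 <= weighting d i 0 <= 9 / 8.
  by have := w_dev i; rewrite ler_norml => /andP[a b]; apply/andP; split; lra.
have S_bd : 0 < magnitude d <= n%:R * (9 / 8).
  rewrite magnitude_sum; apply/andP; split.
    rewrite (bigD1 (Ordinal X0)) //= ltr_pwDl //.
      by have /andP[] := w_bd (Ordinal X0); lra.
    by apply: sumr_ge0 => i _; have /andP[] := w_bd i; lra.
  apply: (@le_trans _ _ (\sum_(j < n) (9 / 8))).
    by apply: ler_sum => i _; have /andP[] := w_bd i.
  by rewrite sumr_const card_ord -[_ *+ n]mulr_natl.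
have /andP[S_gt0 S_le] := S_bd.
split=> // [i j ij|i]; last by have /andP[] := w_bd i; lra.
rewrite (MPinverse_Kmx X0 uZ ZT) ?gt_eqF // mxE oppr_gt0 pmulr_rlt0 //.
rewrite bordered_blockE subr_lt0 ltr_pdivlMr //.
have : invmx Z i j <= 2 * eps.
  by have := Gdev i j; rewrite (negPf ij) subr0; apply/le_trans/ler_norm.
have /andP[wi _] := w_bd i; have /andP[wj _] := w_bd j => Gij.
apply: (@le_lt_trans _ _ (2 * eps * (n%:R * (9 / 8)))).
  apply: (@le_trans _ _ (2 * eps * magnitude d)).
    by rewrite ler_wpM2r // ltW.
  by rewrite ler_wpM2l // mulr_ge0 // ltW.
have -> : 2 * eps * (n%:R * (9 / 8)) = (n%:R * eps) * (9 / 4) by field.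
rewrite neps; apply: (@lt_le_trans _ _ (7 / 8 * (7 / 8))); first by lra.
by rewrite ler_pM //; lra.
Qed.

Lemma scaled_metric (R : realType) (X : finType) (d : X -> X -> R) t :
  0 < t -> is_metric d -> is_metric (scaled t d).
Proof.
move=> t0 [X0 dge0 d0 dC dtri]; split=> // [x y|x y|x y|x y z]; rewrite /scaled.
- by rewrite mulr_ge0 // ltW.
- rewrite -d0; split=> [/eqP|->]; last by rewrite mulr0.
  by rewrite mulf_eq0 gt_eqF //= => /eqP.
- by rewrite dC.
- by rewrite -mulrDr ler_pM2l.
Qed.

Lemma expRN_le (R : realType) (x : R) : 0 < x -> expR (- x) <= x^-1.
Proof.
move=> x0; rewrite expRN lef_pV2 ?posrE ?expR_gt0 //.
by apply: le_trans (expR_ge1Dx x); rewrite lerDr.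
Qed.

(** The scale T exceeds 16 n / d x y for each pair of points; then e^-x <= 1/x
    yields the bound n e^(- t d x y) <= 1/16. *)
Lemma strongly_positive_definite_scaled (R : realType) (X : finType)
    (d : X -> X -> R) :
  is_metric d ->
  exists2 T : R, 0 < T &
    forall t, T < t -> strongly_positive_definite (scaled t d).
Proof.
move=> dm; have [X0 dge0 d0 dC dtri] := dm.
pose c x y := 16 * #|X|%:R / d x y.
have c_ge0 x y : 0 <= c x y by rewrite divr_ge0 // mulr_ge0.
(* the terms with x = y are 0, as division by 0 gives 0 *)
exists (1 + \sum_x \sum_y c x y).
  by rewrite ltr_pwDl // sumr_ge0 // => x _; rewrite sumr_ge0.
move=> t Tt.
have t0 : 0 < t.
  apply: le_lt_trans Tt; rewrite addr_ge0 // sumr_ge0 // => x _.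
  by rewrite sumr_ge0.
apply: strongly_positive_definite_of_separated; first exact: scaled_metric.
move=> x y xy; have dxy : 0 < d x y.
  by rewrite lt_neqAle dge0 andbT eq_sym; apply: contraNneq xy => /d0 ->.
have ct : c x y <= t.
  apply: le_trans (ltW Tt); rewrite (bigD1 x) //= (bigD1 y) //=.
  have : 0 <= \sum_(i | i != y) c x i by rewrite sumr_ge0.
  have : 0 <= \sum_(i | i != x) \sum_j c i j.
    by rewrite sumr_ge0 // => i _; rewrite sumr_ge0.
  by lra.
have n_gt0 : 0 < #|X|%:R :> R by rewrite ltr0n.
have td : 0 < t * d x y by rewrite mulr_gt0.
apply: (@le_trans _ _ (#|X|%:R * (t * d x y)^-1)).
  by rewrite ler_pM2l // expRN_le.
rewrite ler_pdivrMr // mulrC ler_pdivlMr //.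
by move: ct; rewrite /c ler_pdivrMr // mulrC.
Qed.

Theorem theorem5p9 (R : realType) :
  (forall (X : finType) (d : X -> X -> R) (alpha : R),
     is_metric d -> strongly_positive_definite d ->
     (alpha < -1 -> set_increasing (neg_inv_magnitude d alpha)) /\
     (alpha < - (3 / 2) -> strictly_submodular (neg_inv_magnitude d alpha)))
  /\
  (forall (X' : finType) (d' : X' -> X' -> R),
     is_metric d' ->
     exists2 T : R, 0 < T &
       forall t : R, T < t ->
         positive_definite (scaled t d') /\
         forall alpha : R, alpha < - (3 / 2) ->
           strictly_submodular (neg_inv_magnitude (scaled t d') alpha)).
Proof.
have spd_submodular (X : finType) (d : X -> X -> R) (alpha : R) :
    is_metric d -> strongly_positive_definite d ->
    (alpha < -1 -> set_increasing (neg_inv_magnitude d alpha)) /\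
    (alpha < - (3 / 2) -> strictly_submodular (neg_inv_magnitude d alpha)).
  move=> dm dspd; have BT := bordered_inverse_setT dm dspd.
  have dxx x := metric_diag x dm; have [_ _ _ dC _] := dm; split.
    exact: neg_inv_magnitude_increasing.
  exact: neg_inv_magnitude_submodular.
split=> [//|X d dm]; have [T T0 Tspd] := strongly_positive_definite_scaled dm.
exists T => // t Tt; have tspd := Tspd t Tt.
split=> [|alpha]; first by case: tspd.
have t0 : 0 < t by apply: lt_trans Tt.
by have [] := spd_submodular X _ alpha (scaled_metric t0 dm) tspd.
Qed.
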